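(* Let $n$ be a positive even integer, let $(B,d)$ be a metric space of finite generalized roundness $\mathfrak{q}(B)$, and let $f:\mathsf{M}_{n+2}\to B$ be a function. Then for every real $p$ with $0\leq p\leq\mathfrak{q}(B)$ and every integer $t$ with $-n\leq t\leq 0$, $$\frac{1}{N_{(t,n+1)}}\sum_{\{x,y\}\in\Theta_t^{n+1}}d(f(x),f(y))^p\ \geq\ \left(1-\frac{1}{n+2}\right)^n\frac{1}{N_{(t+n,1)}}\sum_{\{u,v\}\in\Theta_{t+n}^1}d(f(u),f(v))^p,$$ where $\Theta_s^m$ is the set of $(s,m)$-pairs in $\mathsf{M}_{n+2}$ and $N_{(s,m)}=|\Theta_s^m|$. If instead $(B,d)$ is a metric space with $\mathfrak{q}(B)=\infty$ and $f:\mathsf{M}_{n+2}\to B$ is a function, then the inequality $$\frac{1}{N_{(t,n+1)}}\sum_{\{x,y\}\in\Theta_t^{n+1}}d(f(x),f(y))^p\ \geq\ \left(1-\frac{1}{n+2}\right)^n\frac{1}{N_{(t+n,1)}}\sum_{\{u,v\}\in\Theta_{t+n}^1}d(f(u),f(v))^p$$ holds for all real $p\geq 0$ and all integers $t$ with $-n\leq t\leq 0$.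
   Context: For a positive even integer $k$, $\mathsf{L}_k=\{j k^{-k}: j\in\mathbb{Z},\ 1\leq j\leq k^{2k}\}$ with the cyclic metric $\chi(x,y)=\min\{|x-y|,\,k^k-|x-y|\}$, and $\mathsf{M}_k=\prod_{i=1}^{k^k}\mathsf{L}_k$ with the metric $d_\infty(x,y)=\max_i\chi(x_i,y_i)$. For integers $s,m$ with $|s|<k$ and $0<m<k$, an unordered pair $\{x,y\}\subset\mathsf{M}_k$ is an $(s,m)$-pair if (1) $\chi(x_i,y_i)=2^s$ whenever $x_i\neq y_i$, and (2) the set $\{i:x_i\neq y_i\}$ has cardinality $k^m$. $\Theta_s^m$ denotes the set of $(s,m)$-pairs in $\mathsf{M}_k$. In the claim, $k=n+2$. The generalized roundness $\mathfrak{q}(X)\in[0,\infty]$ of a metric space $(X,d)$ is the supremum of the set of all $p\geq 0$ such that for all integers $n\geq 2$ and all (not necessarily distinct) points $x_1,\dots,x_n,y_1,\dots,y_n\in X$, $$\sum_{1\leq i<j\leq n}\{d(x_i,x_j)^p+d(y_i,y_j)^p\}\leq\sum_{1\leq i,j\leq n}d(x_i,y_j)^p.$$ *)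

(* Defs.v *)
From HB Require Import structures.
From mathcomp Require Import all_boot all_order all_algebra.
From mathcomp Require Import all_classical all_reals all_analysis.

Set Implicit Arguments.
Unset Strict Implicit.
Unset Printing Implicit Defensive.

Import Order.TTheory GRing.Theory Num.Theory.
Import numFieldNormedType.Exports.

Local Open Scope ring_scope.

Definition L_seq (R : realType) (k : nat) : seq R :=
  [seq j%:R * k%:R ^- k | j <- iota 1 (k ^ (2 * k))].

(* The subset L_k of R as a finite type; [ssval] is the inclusion into R. *)
Definition L (R : realType) (k : nat) : Type := seq_sub (L_seq R k).

Definition chi (R : realType) (k : nat) (x y : L R k) : R :=
  Num.min `|ssval x - ssval y| (k%:R ^+ k - `|ssval x - ssval y|).

Definition M (R : realType) (k : nat) : Type := {ffun 'I_(k ^ k) -> L R k}.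

(* Meant for |s| < k and 0 < m < k. *)
Definition is_sm_pair (R : realType) (k : nat) (s : int) (m : nat)
    (x y : M R k) : bool :=
  [forall i, (x i != y i) ==> (chi (x i) (y i) == 2 ^ s)] &&
  (#|[set i | x i != y i]%SET| == k ^ m)%N.

Definition Theta (R : realType) (k : nat) (s : int) (m : nat) :
    {set {set M R k}} :=
  [set P | [exists x : M R k, exists y : M R k,
              (P == [set x; y]%SET) && is_sm_pair s m x y]]%SET.

Definition N (R : realType) (k : nat) (s : int) (m : nat) : R :=
  #|Theta R k s m|%:R.

(* The value at the unordered pair P = {x, y} of a symmetric function g of two
   arguments. By symmetry the choice of the order of x and y is irrelevant
   (lemma on_pairE). *)
Definition on_pair (R : realType) (T : finType) (g : T -> T -> R)
    (P : {set T}) : R :=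
  if [pick xy : T * T | P == [set xy.1; xy.2]%SET] is Some xy
  then g xy.1 xy.2 else 0.

Lemma on_pairE (R : realType) (T : finType) (g : T -> T -> R) (x y : T) :
  (forall a b, g a b = g b a) -> on_pair g [set x; y]%SET = g x y.
Proof.
move=> gC; rewrite /on_pair; case: pickP => [[a b] /= /eqP e|/(_ (x, y))].
  have: a \in [set x; y]%SET by rewrite e set21.
  have: b \in [set x; y]%SET by rewrite e set22.
  have: x \in [set a; b]%SET by rewrite -e set21.
  have: y \in [set a; b]%SET by rewrite -e set22.
  rewrite !inE.
  by do 4!case/orP=> /eqP ?; subst=> //; rewrite gC.
by rewrite /= eqxx.
Qed.

(* [powR] has 0 `^ 0 = 1; this matters only for p = 0. *)
Definition dist_pow (R : realType) (B : metricType R) (T : Type) (f : T -> B)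
    (p : R) (x y : T) : R := mdist (f x) (f y) `^ p.

Lemma dist_powC (R : realType) (B : metricType R) (T : Type) (f : T -> B)
  (p : R) (x y : T) : dist_pow f p x y = dist_pow f p y x.
Proof. by rewrite /dist_pow metric_sym. Qed.

Definition roundness_ineq (R : realType) (X : metricType R) (p : R) : Prop :=
  forall (n : nat) (x y : 'I_n -> X), (2 <= n)%N ->
    \sum_(i < n) \sum_(j < n | (i < j)%N)
       (mdist (x i) (x j) `^ p + mdist (y i) (y j) `^ p) <=
    \sum_(i < n) \sum_(j < n) mdist (x i) (y j) `^ p.

Definition generalized_roundness (R : realType) (X : metricType R) : \bar R :=
  ereal_sup [set p%:E | p in [set p : R | 0 <= p /\ roundness_ineq X p]]%classic.

(* Main.v *)
Require Import Defs.
From mathcomp Require Import all_boot all_order all_algebra all_fingroup.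
From mathcomp Require Import all_classical all_reals all_analysis.
From mathcomp Require Import zify ring lra.

(* The roundness inequality applied to a double simplex u_1, ..., u_k,
   v_1, ..., v_k in M_k all of whose cross pairs {u_i, v_j} are (s, m+1)-pairs
   and all of whose inner pairs {u_i, u_j}, {v_i, v_j} are (s+1, m)-pairs
   compares k^2 pairs of the first kind with k(k-1) pairs of the second kind.
   The isometries of M_k given by permutations of the coordinates and isometries
   of each coordinate act transitively on the (s, m)-pairs, for all s and m, so
   that averaging the inequality over this group bounds the average over
   Theta_s^{m+1} from below by 1 - 1/k times the average over Theta_{s+1}^m;
   n such steps give the theorem.
   That every p below the generalized roundness satisfies the roundness
   inequality is Schoenberg's theorem (a conditionally negative definite kernel
   stays so when raised to a power a < 1). It is obtained here from Schur's
   product theorem and the binomial series of (1 - y)^a, all of whose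
   coefficients but the first are nonpositive. *)

Set Implicit Arguments.
Unset Strict Implicit.
Unset Printing Implicit Defensive.

Import Order.TTheory GRing.Theory Num.Theory.
Import numFieldNormedType.Exports.

Local Open Scope ring_scope.

(** * Positive semidefinite kernels *)

Section Kernels.
Variables (R : realType) (T : finType).
Implicit Types (K L : T -> T -> R) (c u : T -> R).

Definition quad K c : R := \sum_x \sum_y c x * c y * K x y.

Definition psd K : Prop :=
  (forall x y, K x y = K y x) /\ forall c, 0 <= quad K c.

Definition cnd K : Prop := forall c, \sum_x c x = 0 -> quad K c <= 0.

Lemma eq_quad K L c : (forall x y, K x y = L x y) -> quad K c = quad L c.
Proof. by move=> e; apply: eq_bigr => x _; apply: eq_bigr => y _;
  rewrite e. Qed.

Lemma quadD K L c : quad (fun x y => K x y + L x y) c = quad K c + quad L c.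
Proof.
rewrite -big_split; apply: eq_bigr => x _; rewrite -big_split.
by apply: eq_bigr => y _; rewrite mulrDr.
Qed.

Lemma quadZ a K c : quad (fun x y => a * K x y) c = a * quad K c.
Proof.
rewrite mulr_sumr; apply: eq_bigr => x _; rewrite mulr_sumr.
by apply: eq_bigr => y _; rewrite mulrCA.
Qed.

Lemma quad_mul u v c :
  quad (fun x y => u x * v y) c = (\sum_x c x * u x) * (\sum_y c y * v y).
Proof.
rewrite mulr_suml; apply: eq_bigr => x _; rewrite mulr_sumr.
by apply: eq_bigr => y _; ring.
Qed.

Lemma psdD K L : psd K -> psd L -> psd (fun x y => K x y + L x y).
Proof.
move=> [Ks Kp] [Ls Lp]; split=> [x y|c]; first by rewrite Ks Ls.
by rewrite quadD addr_ge0.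
Qed.

Lemma psdZ a K : 0 <= a -> psd K -> psd (fun x y => a * K x y).
Proof.
move=> a0 [Ks Kp]; split=> [x y|c]; first by rewrite Ks.
by rewrite quadZ mulr_ge0.
Qed.

Lemma psd_rank1 u : psd (fun x y => u x * u y).
Proof.
split=> [x y|c]; first by rewrite mulrC.
by rewrite quad_mul -expr2 sqr_ge0.
Qed.

(** Along the line through [c] in the direction of the basis vector at [z], the form is a quadratic
    polynomial in [t]. Suitable values of [t] turn its nonnegativity into the next three facts. *)
Lemma quad_shift K c z t : (forall x y, K x y = K y x) ->
  quad K (fun x => c x + t * (x == z)%:R) =
  quad K c + (\sum_x c x * K z x) * t *+ 2 + t ^+ 2 * K z z.
Proof.
move=> Ks.
have sum_z (F : T -> R) : \sum_y (y == z)%:R * F y = F z.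
  rewrite (bigD1 z) //= eqxx mul1r big1 ?addr0// => y /negbTE ->.
  by rewrite mul0r.
transitivity (\sum_x (\sum_y c x * c y * K x y + t * (c x * K z x)
     + (x == z)%:R * (t * (\sum_y c y * K z y)) +
       (x == z)%:R * (t ^+ 2 * K z z))).
  apply: eq_bigr => x _.
  rewrite -(sum_z (fun y => c x * K y x)) mulr_sumr -big_split /=.
  case: (eqVneq x z) => [->|_]; last first.
    rewrite /= !mul0r !addr0; apply: eq_bigr => y _; rewrite (Ks y x); ring.
  rewrite /= !mul1r -(sum_z (fun y => t ^+ 2 * K y z)) mulr_sumr.
  rewrite -!big_split; apply: eq_bigr => y _ /=; rewrite (Ks y z); ring.
rewrite !big_split /= (sum_z (fun=> _)) (sum_z (fun=> _)) -mulr_sumr.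
rewrite -/(quad K c); ring.
Qed.

Lemma psd_cauchy K z c : psd K -> 0 < K z z ->
  (K z z)^-1 * (\sum_x c x * K z x) ^+ 2 <= quad K c.
Proof.
move=> [Ks Kp] K0; set b := \sum_x _.
(* This value of [t] minimises the polynomial of [quad_shift]. *)
have := Kp (fun x => c x + - (b / K z z) * (x == z)%:R).
rewrite quad_shift// -/b => h; rewrite -subr_ge0; move: h.
by congr (is_true (0 <= _)); field; rewrite gt_eqF.
Qed.

Lemma psd_diag_ge0 K z : psd K -> 0 <= K z z.
Proof.
move=> [Ks Kp]; have := Kp (fun x => 0 + 1 * (x == z)%:R).
rewrite quad_shift// big1 ?(mul0r, addr0) => [|x _]; last by rewrite mul0r.
rewrite /quad big1 ?(add0r, expr1n, mul1r, mul0rn)// => x _.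
by rewrite big1// => y _; rewrite !mul0r.
Qed.

(** When [K z z = 0] the polynomial of [quad_shift] is affine in [t], so its slope must vanish. *)
Lemma psd_diag0 K z y : psd K -> K z z = 0 -> K z y = 0.
Proof.
move=> [Ks Kp] K0; apply/eqP; apply: contraT => Kzy.
pose c x : R := 0 + 1 * (x == y)%:R.
have cK : \sum_x c x * K z x = K z y.
  rewrite (bigD1 y)//= big1 => [|x /negbTE xy]; rewrite /c ?eqxx ?xy /=; ring.
(* With a nonzero slope, this [t] would give the form the value -1. *)
have := Kp (fun x => c x + (- (quad K c + 1) / (K z y *+ 2)) * (x == z)%:R).
rewrite quad_shift// K0 cK.
have -> : quad K c + K z y * (- (quad K c + 1) / (K z y *+ 2)) *+ 2 +
  (- (quad K c + 1) / (K z y *+ 2)) ^+ 2 * 0 = -1 by field.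
by rewrite ler0N1.
Qed.

(* Schur's product theorem: one step of Gaussian elimination replaces K by its
   Schur complement at z plus a rank one kernel, and the Hadamard product of L
   with a rank one kernel is a congruence of L. *)
Lemma psdM K L : psd K -> psd L -> psd (fun x y => K x y * L x y).
Proof.
move=> Kpsd Lpsd; split=> [x y|c].
  by rewrite (proj1 Kpsd) (proj1 Lpsd).
(* Induction on the size of a set [S] outside which the rows of [K] vanish. Each round removes one
   index [z] from [S]: a pivot if [K z z > 0], an already null row otherwise. *)
have [n] := ubnP #|[set: T]|.
have : forall x y, x \notin [set: T]%SET -> K x y = 0 by move=> x y;
  rewrite inE.
elim: n [set: T]%SET K Kpsd => [//|n IH] S K Kpsd KS; rewrite ltnS => Sn.
case: (set_0Vmem S) => [S0|[z zS]].
  rewrite /quad big1// => x _; rewrite big1// => y _.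
  by rewrite KS ?S0 ?inE// mul0r mulr0.
have cardS : (#|S :\ z| < n)%N.
  by move: Sn; rewrite (cardsD1 z S) zS.
have [Kz|Kz] := eqVneq (K z z) 0.
  apply: (IH (S :\ z)%SET) => // x y; rewrite !inE negb_and negbK.
  by case/orP => [/eqP ->|/KS //]; exact: psd_diag0.
have K0 : 0 < K z z by rewrite lt_neqAle eq_sym Kz psd_diag_ge0.
pose K' x y := K x y - (K z z)^-1 * (K z x * K z y).
have K'psd : psd K'.
  split=> [x y|d]; first by rewrite /K' (proj1 Kpsd) (mulrC (K z x)).
  have -> : quad K' d = quad K d - (K z z)^-1 * (\sum_x d x * K z x) ^+ 2.
    rewrite expr2 -(quad_mul (K z) (K z)) -mulNr -quadZ -quadD.
    by apply: eq_quad => x y; rewrite mulNr.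
  by rewrite subr_ge0 psd_cauchy.
have -> : quad (fun x y => K x y * L x y) c =
    quad (fun x y => K' x y * L x y) c + (K z z)^-1 * quad L (fun x =>
      c x * K z x).
  rewrite -quadZ -/(quad _ _).
  transitivity (quad (fun x y => K' x y * L x y) c +
     quad (fun x y => (K z z)^-1 * (K z x * K z y * L x y)) c).
    by rewrite -quadD; apply: eq_quad => x y; rewrite /K'; ring.
  congr (_ + _); apply: eq_bigr => x _; apply: eq_bigr => y _; ring.
apply: addr_ge0; last by apply: mulr_ge0;
  [rewrite invr_ge0 ltW|apply: (proj2 Lpsd)].
apply: (IH (S :\ z)%SET) => // x y; rewrite !inE negb_and negbK /K'.
case/orP => [/eqP ->|xS]; first by rewrite mulKf ?subrr.
by rewrite (KS _ _ xS) (proj1 Kpsd z x) (KS _ _ xS) mul0r mulr0 subrr.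
Qed.

Lemma psd1 : psd (fun _ _ => 1).
Proof.
have [_ h] := psd_rank1 (fun=> 1); split=> // c.
by have := h c; rewrite mulr1.
Qed.

Lemma psdX K n : psd K -> psd (fun x y => K x y ^+ n).
Proof.
move=> Kpsd; elim: n => [|n IH]; first exact: psd1.
have [Ks h] := psdM Kpsd IH.
by split=> [x y|c]; [rewrite (proj1 Kpsd)|under eq_quad do rewrite exprS].
Qed.

End Kernels.

(** * The binomial series *)

Local Open Scope classical_set_scope.
Local Open Scope ring_scope.

Section BinomialSeries.
Variables (R : realType) (a : R).
Hypotheses (a_gt0 : 0 < a) (a_lt1 : a < 1).

(* The coefficient of y^n in the expansion of (1 - y)^a. *)
Definition binom_coef (n : nat) : R := \prod_(i < n) ((i%:R - a) / i.+1%:R).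

Lemma binom_coefS n : n.+1%:R * binom_coef n.+1 = (n%:R - a) * binom_coef n.
Proof. by rewrite /binom_coef big_ord_recr /= mulrCA mulrC mulrCA divff
  ?mulr1// mulrC. Qed.

(** The sequence [n%:R * binom_coef n] equals -a at n = 1 and is multiplied by 1 - a/n, a number in
    [0, 1], at each step. The upper bound gives the signs of the coefficients, both bounds control
    the remainder of the series. *)
Lemma binom_coef_bound n : -1 <= n.+1%:R * binom_coef n.+1 <= 0.
Proof.
elim: n => [|n /andP[IH1 IH2]].
  by rewrite binom_coefS /binom_coef big_ord0; move: a_gt0 a_lt1; lra.
set b := n.+1%:R * binom_coef n.+1 in IH1 IH2.
have n0 : (0 : R) < n.+1%:R by [].
have -> : n.+2%:R * binom_coef n.+2 = b * (1 - a / n.+1%:R).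
  by rewrite binom_coefS /b; field; rewrite nat1r gt_eqF.
have a1 : a / n.+1%:R <= 1.
  by rewrite ler_pdivrMr// mul1r (le_trans (ltW a_lt1))// ler1n.
have a0 : 0 <= a / n.+1%:R by rewrite divr_ge0 ?ltW.
move: (a / _) b IH1 IH2 a1 a0 => t b; clear => *; by apply/andP; split; nra.
Qed.

Lemma binom_coef_le0 n : binom_coef n.+1 <= 0.
Proof.
have /andP[_] := binom_coef_bound n.
by rewrite pmulr_rle0.
Qed.

Definition binom_poly (m : nat) : {poly R} :=
  \sum_(i < m.+1) binom_coef i *: 'X^i.

Lemma binom_poly0 m : (binom_poly m).[0] = 1.
Proof.
rewrite /binom_poly horner_sum big_ord_recl big1 => [|i _].
  by rewrite /binom_coef big_ord0 !hornerE.
by rewrite !hornerE expr0n /= mulr0.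
Qed.

(** The function g(y) = (1 - y)^a solves (1 - y) g' + a g = 0. For a partial sum, the recurrence
    [binom_coefS] cancels every coefficient but the last. *)
Lemma binom_poly_ode m y :
  (1 - y) * (binom_poly m)^`().[y] + a * (binom_poly m).[y] =
  - (m.+1%:R * binom_coef m.+1) * y ^+ m.
Proof.
rewrite binom_coefS; elim: m => [|m IH].
  rewrite /binom_poly big_ord1 expr0 alg_polyC derivC !hornerE; ring.
rewrite /binom_poly big_ord_recr /= -/(binom_poly m) derivD !hornerD.
rewrite derivZ derivXn /= !hornerE hornerMn !hornerE.
have -> : (1 - y) * ((binom_poly m)^`().[y] +
  binom_coef m.+1 * (y ^+ m *+ m.+1))
  + a * ((binom_poly m).[y] + binom_coef m.+1 * y ^+ m.+1) =
  ((1 - y) * (binom_poly m)^`().[y] + a * (binom_poly m).[y]) +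
  (1 - y) * y ^+ m * (m.+1%:R * binom_coef m.+1) +
  a * binom_coef m.+1 * y ^+ m.+1 by rewrite -mulr_natr; ring.
rewrite IH binom_coefS [in RHS]mulrBl opprB binom_coefS exprS; ring.
Qed.

Lemma is_derive_onem_powR (b y : R) : y < 1 ->
  is_derive y 1 (fun x => (1 - x) `^ b) (- (b * (1 - y) `^ (b - 1))).
Proof.
move=> y1; have y0 : 0 < 1 - y by rewrite subr_gt0.
have h1 : is_derive y 1 (fun x : R => 1 - x) (-1).
  by have h := is_deriveB (is_derive_cst (1 : R) y 1) (is_derive_id y (1 : R));
    apply: (is_derive_eq h); rewrite sub0r.
have := @is_derive1_comp _ (fun x : R => x `^ b) (fun x =>
  1 - x) y _ _ (is_derive1_powR b y0) h1.
by rewrite mulrN1.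
Qed.

(* The quotient of the partial sum by (1 - y)^a has a derivative with only one
   term, of order y^m. *)
Lemma cvg_binom_poly (y : R) : 0 <= y < 1 ->
  (binom_poly m).[y] @[m --> \oo] --> (1 - y) `^ a.
Proof.
move=> /andP[y0 y1].
have [->|yn0] := eqVneq y 0.
  rewrite subr0 powR1; under eq_fun do rewrite binom_poly0; exact: cvg_cst.
have {y0} y0 : 0 < y by rewrite lt_neqAle eq_sym yn0.
have omy : 0 < 1 - y by rewrite subr_gt0.
pose G m (x : R) : R := (binom_poly m).[x] * (1 - x) `^ (- a).
(* The maximum of (1 - x)^(-a - 1) over [0, y], attained at y because the exponent is negative. *)
pose C := (1 - y) `^ (- a - 1).
(* Since [G m 0 = 1], the mean value theorem on [0, y] reduces the bound to the derivative [dG],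
   which lies between 0 and [C * y ^+ m]. *)
have bound m : 1 <= G m y <= 1 + C * y ^+ m.
  pose dG (x : R) : R := - (m.+1%:R * binom_coef m.+1) * x ^+ m * (1 - x) `^ (-
    a - 1).
  have dGP (x : R) : x < 1 -> is_derive x (1 : R) (G m) (dG x).
    move=> x1.
    have h := is_deriveM (is_derive_poly (binom_poly m) x) (is_derive_onem_powR
      (-a) x1).
    apply: (is_derive_eq h); rewrite /dG -binom_poly_ode /GRing.scale /=.
    have -> : (1 - x) `^ (- a) = (1 - x) * (1 - x) `^ (- a - 1).
      have z0 : 0 < 1 - x by rewrite subr_gt0.
      transitivity ((1 - x) `^ (1 + (- a - 1))); first by congr (_ `^ _); ring.
      by rewrite powRD ?powRr1 ?(ltW z0)// (gt_eqF z0) implybT.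
    ring.
  have [||x] := @MVT _ (G m) dG 0 y y0.
  - by move=> x; rewrite in_itv/= => /andP[_ xy]; apply: dGP;
      exact: lt_trans xy y1.
  - apply: derivable_within_continuous => x; rewrite in_itv/= => /andP[_ xy].
    have h := dGP x (le_lt_trans xy y1); exact: ex_derive.
  rewrite in_itv/= => /andP[x0 xy].
  rewrite {2}/G binom_poly0 subr0 powR1 mulr1 subr0 => /(canRL (subrK _)) ->.
  have /andP[b1 b0] := binom_coef_bound m.
  have xm : 0 <= x ^+ m <= y ^+ m.
    rewrite exprn_ge0 ?(ltW x0)//=.
    by apply: lerXn2r; rewrite ?nnegrE; exact: ltW.
  have xC : 0 <= (1 - x) `^ (- a - 1) <= C.
    rewrite powR_ge0 /C -opprD !powRN lef_pV2 ?posrE ?powR_gt0 ?subr_gt0//.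
      apply: ge0_ler_powR; rewrite ?nnegrE ?subr_ge0 ?ltW ?(lt_trans xy)//.
        by rewrite addr_gt0.
      by rewrite ltrD2l ltrN2.
    exact: lt_trans xy y1.
  have /andP[x0' xm'] := xm; have /andP[c0 cC] := xC.
  have d1 : 0 <= x ^+ m * (1 - x) `^ (- a - 1) <= C * y ^+ m.
    by rewrite mulr_ge0//= mulrC ler_pM.
  have /andP[d0 d1'] := d1.
  have e1 : 0 <= dG x <= C * y ^+ m.
    rewrite /dG -mulrA; apply/andP; split; first by rewrite mulr_ge0// oppr_ge0.
    by apply: (le_trans _ d1'); rewrite ler_piMl// lerNl.
  have /andP[e0 e1'] := e1.
  apply/andP; split; first by rewrite lerDr mulr_ge0// ltW.
  rewrite addrC lerD2l; apply: (le_trans _ e1').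
  by rewrite ler_piMr// ltW.
have cG : G m y @[m --> \oo] --> (1 : R).
  apply: (@squeeze_cvgr _ _ _ _ (fun=> 1) (fun m => 1 + C * y ^+ m)).
  - by near=> m; exact: bound.
  - exact: cvg_cst.
  - rewrite -[X in _ --> X]addr0; apply: cvgD; first exact: cvg_cst.
    rewrite -(mulr0 C); apply: cvgMr; apply: cvg_expr.
    by rewrite ger0_norm ?ltW.
have -> : (fun m => (binom_poly m).[y]) = (fun m => G m y * (1 - y) `^ a).
  apply/funext => m; rewrite /G -mulrA -powRD ?addNr ?powRr0 ?mulr1//.
  by apply/implyP => _; rewrite gt_eqF.
rewrite -[X in _ --> X]mul1r; exact: cvgMl.
Unshelve. all: by end_near. Qed.

End BinomialSeries.

(** * Powers of negative definite kernels *)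

(** At a positive limit the power is derivable, hence continuous. At the limit 0, which occurs for
    kernels vanishing on the diagonal, the threshold e^(1/a) does the work. *)
Lemma cvg_powR (R : realType) (a : R) (u : nat -> R) (l : R) : 0 < a ->
  (forall n, 0 <= u n) -> u n @[n --> \oo] --> l ->
  u n `^ a @[n --> \oo] --> l `^ a.
Proof.
move=> a0 u0 ul.
have l0 : 0 <= l.
  apply: (@ler_cvg_to _ \oo _ _ (fun=> 0) u); [exact: cvg_cst|exact: ul|].
  by near=> n; exact: u0.
have [l_eq0|l_neq0] := eqVneq l 0.
  rewrite l_eq0 powR0 ?gt_eqF//; apply/cvgr0Pnorm_lt => e e0.
  have e1 : 0 < e `^ a^-1 by rewrite powR_gt0.
  move: ul; rewrite l_eq0 => /cvgr0Pnorm_lt/(_ _ e1) ul.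
  near=> n; rewrite ger0_norm ?powR_ge0//.
  have -> : e = (e `^ a^-1) `^ a by rewrite -powRrM mulVf ?gt_eqF// powRr1 ?ltW.
  rewrite gt0_ltr_powR ?nnegrE ?(ltW e1)// -[u n]ger0_norm//.
  by near: n.
have {l_neq0} l0' : 0 < l by rewrite lt_neqAle eq_sym l_neq0.
have hc : {for l, continuous (fun x : R => x `^ a)}.
  apply/differentiable_continuous/derivable1_diffP.
  by apply: derivable_powR; rewrite in_itv/= l0'.
exact: (cvg_comp u (fun x : R => x `^ a) ul hc).
Unshelve. all: by end_near. Qed.

Lemma cvg_quad (R : realType) (T : finType) (K : nat -> T -> T -> R)
    (L : T -> T -> R) (c : T -> R) :
  (forall x y, K n x y @[n --> \oo] --> L x y) ->
  quad (K n) c @[n --> \oo] --> quad L c.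
Proof.
move=> KL; apply: cvg_big => [|x _]; first exact: add_continuous.
apply: cvg_big => [|y _]; first exact: add_continuous.
exact: cvgMr.
Qed.

Lemma quad_lim_le0 (R : realType) (T : finType) (K : nat -> T -> T -> R)
    (L : T -> T -> R) (c : T -> R) :
  (forall x y, K n x y @[n --> \oo] --> L x y) ->
  (forall n, quad (K n) c <= 0) -> quad L c <= 0.
Proof.
move=> KL K0; apply: (@ler_cvg_to _ \oo _ _ (fun n => quad (K n) c) (fun=> 0)).
- exact: cvg_quad.
- exact: cvg_cst.
- by near=> n; exact: K0.
Unshelve. all: by end_near. Qed.

(** In the binomial series the constant term contributes 0 because [c] sums to 0; every further term
    is a nonpositive coefficient times a power of [X], which is positive semidefinite by Schur's
    theorem. *)
Lemma psd_onem_powR_cnd (R : realType) (T : finType) (a : R) (X : T -> T -> R) :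
  0 < a < 1 -> psd X -> (forall x y, 0 <= X x y < 1) ->
  cnd (fun x y => (1 - X x y) `^ a).
Proof.
move=> /andP[a0 a1] Xpsd X01 c c0.
apply: (@quad_lim_le0 _ _ (fun m x y => (binom_poly a m).[X x y])).
  by move=> x y; exact: cvg_binom_poly.
move=> m; rewrite /binom_poly; elim: m => [|m IH].
  rewrite (@eq_quad _ _ _ (fun _ _ => 1 * binom_coef a 0)) => [|x y].
    by rewrite quad_mul -mulr_suml c0 !mul0r.
  by rewrite big_ord1 !hornerE.
rewrite (@eq_quad _ _ _ (fun x y =>
    (\sum_(i < m.+1) binom_coef a i *: 'X^i).[X x y] +
    binom_coef a m.+1 * X x y ^+ m.+1)) => [|x y].
  rewrite quadD quadZ.
  have h : 0 <= quad (fun x y => X x y ^+ m.+1) c by apply: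
    (proj2 (psdX _ Xpsd)).
  have b : binom_coef a m.+1 <= 0 by exact: binom_coef_le0.
  by rewrite -[leRHS]addr0 lerD// mulr_le0_ge0.
by rewrite big_ord_recr /= !hornerE.
Qed.

(* Schoenberg's theorem. With D_x := D x o, the kernel
   X = (1 - l D_x) (1 - l D_y) + l (D_x + D_y - D x y) is positive semidefinite
   and equals 1 - l D + O(l^2); a further multiplicative correction of order l^2
   brings it below 1. *)
Lemma cnd_powR (R : realType) (T : finType) (a : R) (D : T -> T -> R) (o : T) :
  0 < a < 1 -> (forall x y, 0 <= D x y) ->
  psd (fun x y => D x o + D y o - D x y) -> cnd (fun x y => D x y `^ a).
Proof.
move=> a01 D0 Kpsd c c0; have /andP[a0 a1] := a01.
pose W : R := 1 + \sum_x \sum_y D x y.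
have DW x y : D x y < W.
  rewrite /W ltr_pwDl// (bigD1 x)//= (bigD1 y)//= -addrA lerDl addr_ge0//.
    exact: sumr_ge0.
  by apply: sumr_ge0 => i _; exact: sumr_ge0.
have W1 : 1 <= W by rewrite lerDl sumr_ge0// => i _; exact: sumr_ge0.
have W0 : 0 < W by exact: lt_le_trans W1.
(* The second-order term in [XE]. It is positive because [W] strictly exceeds all values of [D],
   which keeps [X] below 1 even where [D] vanishes. *)
pose M x y : R := W ^+ 2 - D x o * D y o.
have M0 x y : 0 < M x y.
  by rewrite subr_gt0 expr2 ltr_pM.
(* Tends to 0 while staying at most 1/W, so that [l * D x y <= 1] and [X] is nonnegative. *)
pose l (n : nat) : R := W^-1 * n.+1%:R^-1.
have l0 n : 0 < l n by rewrite mulr_gt0 ?invr_gt0.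
(* By [XE] the approximating kernel is (1 - X)^a up to the positive factor (r l)^a, so the binomial
   series applies to it. *)
apply: (@quad_lim_le0 _ _ (fun n x y => (D x y + l n * M x y) `^ a)).
  move=> x y; apply: cvg_powR => // [n|].
    by apply: addr_ge0 => //; apply: mulr_ge0; exact: ltW.
  rewrite -[X in _ --> X]addr0; apply: cvgD; first exact: cvg_cst.
  rewrite -(mul0r (M x y)); apply: cvgMl.
  rewrite -(mulr0 (W^-1)); apply: cvgMr; exact: cvg_harmonic.
move=> n; have lW : l n <= W^-1.
  by rewrite ler_piMr ?invr_ge0 ?(ltW W0)// invf_le1 ?ler1n.
move: (l n) (l0 n) lW => {l0} {}l l0 lW.
pose r := (1 + l ^+ 2 * W ^+ 2)^-1.
have r0' : 0 < 1 + l ^+ 2 * W ^+ 2 by rewrite ltr_pwDl// mulr_ge0 ?sqr_ge0.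
have r0 : 0 < r by rewrite invr_gt0.
pose X x y := r * ((1 - l * D x o) * (1 - l * D y o)
  + l * (D x o + D y o - D x y)).
have XE x y : 1 - X x y = r * l * (D x y + l * M x y).
  rewrite /X /M /r; field; by rewrite exprMn gt_eqF.
have X0 x y : 0 <= X x y.
  rewrite /X pmulr_rge0//.
  have -> : (1 - l * D x o) * (1 - l * D y o) + l * (D x o + D y o - D x y) =
    (1 - l * D x y) + l ^+ 2 * (D x o * D y o) by ring.
  apply: addr_ge0; last by apply: mulr_ge0; [exact: sqr_ge0|exact: mulr_ge0].
  rewrite subr_ge0 -(@mulVf _ W) ?gt_eqF//.
  by apply: ler_pM => //; exact: ltW.
have X1 x y : X x y < 1.
  by rewrite -subr_gt0 XE mulr_gt0 ?mulr_gt0// ltr_wpDl// mulr_gt0.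
have Xpsd : psd X.
  apply: psdZ; first exact: ltW.
  by apply: psdD; [exact: psd_rank1|apply: psdZ; [exact: ltW|]].
have := psd_onem_powR_cnd a01 Xpsd (fun x y =>
  introT andP (conj (X0 x y) (X1 x y))) c0.
rewrite (@eq_quad _ _ _ (fun x y => (r * l) `^ a * (D x y + l * M x y) `^ a)).
  by rewrite quadZ pmulr_rle0//; apply: powR_gt0; exact: mulr_gt0.
move=> x y; rewrite XE powRM//; first exact/ltW/mulr_gt0.
by apply: addr_ge0 => //; apply: mulr_ge0; exact: ltW.
Qed.

(** * Generalized roundness *)

Lemma cvg_floorM (R : realType) (x : R) :
  (Num.floor (n.+1%:R * x))%:~R / n.+1%:R @[n --> \oo] --> x.
Proof.
apply: (@squeeze_cvgr _ _ _ _ (fun n => x - n.+1%:R^-1) (fun=> x)).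
- near=> n; have n0 : (0 : R) < n.+1%:R by [].
  rewrite ler_pdivlMr// ler_pdivrMr// mulrBl mulVf ?gt_eqF// [x * _]mulrC.
  rewrite Num.Theory.floor_le_tmp// andbT lerBlDr.
  by have := ltW (Num.Theory.floorD1_gt (n.+1%:R * x)); rewrite intrD.
- rewrite -[X in _ --> X]subr0; apply: cvgB; first exact: cvg_cst.
  exact: cvg_harmonic.
- exact: cvg_cst.
Unshelve. all: by end_near. Qed.

(** Integer weights [d] become weights [d'] of sum zero by a correction at [o], and the form of [K]
    at [d] is minus that of [D] at [d']. Homogeneity extends this to rational weights, and
    [cvg_floorM] to real ones. *)
Lemma psd_of_int_cnd (R : realType) (T : finType) (D : T -> T -> R) (o : T) :
  (forall x y, D x y = D y x) -> D o o = 0 ->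
  (forall c : T -> int, \sum_x c x = 0 -> quad D (fun x => (c x)%:~R) <= 0) ->
  psd (fun x y => D x o + D y o - D x y).
Proof.
move=> Ds Do Dint; set K := fun x y => _.
have Kint (d : T -> int) : 0 <= quad K (fun x => (d x)%:~R).
  pose d' x : int := d x + - (\sum_y d y) * (x == o)%:R.
  have d'0 : \sum_x d' x = 0.
    have e1 : \sum_x (x == o)%:R = 1 :> int.
      by rewrite (bigD1 o)//= eqxx big1 => [|x /negbTE -> //].
    by rewrite big_split /= -mulr_sumr e1 mulr1 subrr.
  have := Dint d' d'0.
  have -> : quad D (fun x => (d' x)%:~R) = quad D (fun x =>
    (d x)%:~R + - (\sum_y (d y)%:~R) * (x == o)%:R).
    apply: eq_bigr => x _; apply: eq_bigr => y _; congr (_ * _ * _);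
    by rewrite /d' intrD intrM rmorphN rmorph_sum /=; congr (_ + _ * _);
      case: (_ == _).
  rewrite quad_shift// Do mulr0 addr0 -oppr_ge0.
  congr (is_true (0 <= _)).
  rewrite [RHS](eq_quad (L := fun x y =>
    (D o x * 1 + 1 * D o y) + (-1) * D x y)).
    rewrite quadD quadZ quadD (quad_mul (D o) (fun=> 1)) (quad_mul (fun=> 1) (D
      o)).
    under [\sum_x _ * 1]eq_bigr do rewrite mulr1.
    ring.
  by move=> x y; rewrite /K (Ds x o) (Ds y o); ring.
split=> [x y|c]; first by rewrite /K (Ds x y) (addrC (D x o)).
pose d n x : R := (Num.floor (n.+1%:R * c x))%:~R / n.+1%:R.
apply: (@ler_cvg_to _ \oo _ _ (fun=> 0) (fun n => quad K (d n))).
- exact: cvg_cst.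
- apply: cvg_big => [|x _]; first exact: add_continuous.
  apply: cvg_big => [|y _]; first exact: add_continuous.
  by apply: cvgMl; apply: cvgM; exact: cvg_floorM.
- near=> n.
  have := Kint (fun x => Num.floor (n.+1%:R * c x)).
  have -> : quad K (d n) = n.+1%:R^-1 ^+ 2 * quad K (fun x =>
    (Num.floor (n.+1%:R * c x))%:~R).
    by rewrite -quadZ; apply: eq_bigr => x _; apply: eq_bigr => y _;
      rewrite /d; ring.
  by move=> h; rewrite mulr_ge0// sqr_ge0.
Unshelve. all: by end_near. Qed.

Lemma sum_sym_diag0 (R : realType) (n : nat) (F : 'I_n -> 'I_n -> R) :
  (forall i j, F i j = F j i) -> (forall i, F i i = 0) ->
  \sum_i \sum_j F i j = (\sum_(i < n) \sum_(j < n | (i < j)%N) F i j) *+ 2.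
Proof.
move=> Fs F0.
transitivity (\sum_(i < n) (\sum_(j < n | (i < j)%N) F i j +
  \sum_(j < n | (j < i)%N) F i j)).
  apply: eq_bigr => i _; rewrite (bigID (fun j : 'I_n => (i < j)%N))/=;
    congr (_ + _).
  rewrite (bigD1 i) /=; last by rewrite ltnn.
  rewrite F0 add0r; apply: eq_bigl => j.
  by rewrite -leqNgt [in RHS]ltn_neqAle andbC.
rewrite big_split mulr2n /=; congr (_ + _).
rewrite (exchange_big_dep xpredT)//=; apply: eq_bigr => i _;
  apply: eq_bigr => j _.
exact: Fs.
Qed.

Lemma sum_seqs_nseq (R : realType) (X : Type) (T : finType) (z : T -> X) (m :
  T -> nat) (h : X -> R) :
  \sum_(x <- flatten [seq nseq (m t) (z t) | t <- enum T]) h x =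
    \sum_t (m t)%:R * h (z t).
Proof.
rewrite big_flatten big_map big_enum; apply: eq_bigr => t _.
by rewrite big_nseq iter_addr_0 mulr_natl.
Qed.

Section Roundness.
Variables (R : realType) (X : metricType R).

Definition dpow (p : R) (u v : X) : R := mdist u v `^ p.

Lemma dpow_sym p u v : dpow p u v = dpow p v u.
Proof. by rewrite /dpow metric_sym. Qed.

Lemma dpow_diag p u : 0 < p -> dpow p u u = 0.
Proof. by move=> p0; rewrite /dpow mdistxx powR0 ?gt_eqF. Qed.

Lemma dpow_ge0 p u v : 0 <= dpow p u v.
Proof. exact: powR_ge0. Qed.

(** Symmetry doubles the sums over i < j, and the diagonal terms vanish because p > 0; at p = 0 they
    would be 1. *)
Lemma roundness_ineqP p : 0 < p ->
  roundness_ineq X p <->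
  forall (n : nat) (x y : 'I_n -> X),
    \sum_i \sum_j (dpow p (x i) (x j) + dpow p (y i) (y j)) <=
    (\sum_i \sum_j dpow p (x i) (y j)) *+ 2.
Proof.
move=> p0.
have E n (x y : 'I_n -> X) : \sum_i \sum_j (dpow p (x i) (x j) +
  dpow p (y i) (y j)) =
    (\sum_(i < n) \sum_(j < n | (i < j)%N)
       (mdist (x i) (x j) `^ p + mdist (y i) (y j) `^ p)) *+ 2.
  apply: (sum_sym_diag0 (F := fun i j =>
    dpow p (x i) (x j) + dpow p (y i) (y j))) => [i j|i].
    by rewrite (dpow_sym p (x i)) (dpow_sym p (y i)).
  by rewrite !dpow_diag// addr0.
split=> [h [|[|n]] x y|h n x y _].
- by rewrite !big_ord0 mul0rn.
- rewrite !big_ord1 !dpow_diag// addr0 mulrn_wge0//; exact: dpow_ge0.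
- by rewrite E ler_pMn2r//; exact: h.
- by have := h n x y; rewrite E ler_pMn2r.
Qed.

Lemma roundness_seq p (s1 s2 : seq X) : 0 < p -> roundness_ineq X p ->
  size s1 = size s2 ->
  \sum_(x <- s1) \sum_(y <- s1) dpow p x y +
    \sum_(x <- s2) \sum_(y <- s2) dpow p x y <=
  (\sum_(x <- s1) \sum_(y <- s2) dpow p x y) *+ 2.
Proof.
move=> p0 /(roundness_ineqP p0) h e.
case: s1 s2 e => [|u s1] s2 e.
  by case: s2 e => //; rewrite !big_nil addr0 mul0rn.
have := h (size (u :: s1)) (fun i => nth u (u :: s1) i) (fun i => nth u s2 i).
rewrite !(big_nth u) -e !big_mkord.
under eq_bigr do rewrite big_split; rewrite big_split /=.
under [in X in _ -> X]eq_bigr do rewrite (big_nth u) big_mkord.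
under [X in _ -> _ + X <= _]eq_bigr do rewrite (big_nth u) -e big_mkord.
by under [X in _ -> _ <= X *+ _]eq_bigr do rewrite (big_nth u) -e big_mkord.
Qed.

(** Points may repeat in the roundness inequality: [z t] is listed [|c t|] times, in the first list
    if [c t] is nonnegative and in the second otherwise. The lists have equal length because [c]
    sums to 0. *)
Lemma roundness_int_cnd p (T : finType) (z : T -> X) (c : T -> int) :
  0 < p -> roundness_ineq X p -> \sum_t c t = 0 ->
  quad (fun s t => dpow p (z s) (z t)) (fun t => (c t)%:~R) <= 0.
Proof.
move=> p0 rp c0.
pose m1 t := if 0 <= c t then `|c t|%N else 0%N.
pose m2 t := if 0 <= c t then 0%N else `|c t|%N.
have cE t : c t = (m1 t)%:Z - (m2 t)%:Z.
  rewrite /m1 /m2; case: (leP 0 (c t)) => h; first by rewrite subr0 gez0_abs.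
  by rewrite sub0r ltz0_abs// opprK.
have m12 : (\sum_t m1 t = \sum_t m2 t)%N.
  apply/eqP; rewrite -(eqr_nat int) -subr_eq0 !natr_sum -sumrB.
  by rewrite -[X in _ == X]c0; apply/eqP/eq_bigr => t _; rewrite cE !natz.
pose s m := flatten [seq nseq (m t) (z t) | t <- enum T].
have sizes m : size (s m) = (\sum_t m t)%N.
  rewrite size_flatten /shape -map_comp sumnE big_map big_enum /=.
  by apply: eq_bigr => t _; rewrite size_nseq.
have := @roundness_seq p (s m1) (s m2) p0 rp _.
rewrite !sizes => /(_ m12).
pose q (a b : T -> nat) : R := \sum_x \sum_y (a x)%:R * (b y)%:R * dpow p (z x)
  (z y).
have sE a b : \sum_(x <- s a) \sum_(y <- s b) dpow p x y = q a b.
  rewrite sum_seqs_nseq; apply: eq_bigr => x _; rewrite sum_seqs_nseq mulr_sumr.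
  by apply: eq_bigr => y _; rewrite mulrA.
rewrite !sE -subr_le0.
have q21 : q m2 m1 = q m1 m2.
  rewrite /q exchange_big; apply: eq_bigr => x _; apply: eq_bigr => y _ /=.
  by rewrite dpow_sym (mulrC _%:R).
congr (is_true (_ <= 0)); rewrite mulr2n -{1}q21 /q -!big_split -sumrB /=.
apply: eq_bigr => x _; rewrite -!big_split -sumrB /=; apply: eq_bigr => y _.
rewrite !cE !intrD !rmorphN /=; ring.
Qed.

(** Schoenberg's theorem with exponent p/q, applied to the q-th powers of the distances; weights 1
    on the x's and -1 on the y's recover the roundness inequality. *)
Lemma roundness_lt p q : 0 < p -> p < q -> roundness_ineq X q -> roundness_ineq
  X p.
Proof.
move=> p0 pq rq; apply/(roundness_ineqP p0) => -[|n] x y.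
  by rewrite !big_ord0 mul0rn.
have q0 : 0 < q by exact: lt_trans pq.
(* Indexing by a disjoint sum keeps coinciding points apart. *)
pose z (t : 'I_n.+1 + 'I_n.+1) := match t with inl i => x i | inr i => y i end.
pose D s t := dpow q (z s) (z t).
have cD : cnd (fun s t => D s t `^ (p / q)).
  apply: (@cnd_powR _ _ _ _ (inl ord0)) => [|s t|].
  - by rewrite divr_gt0//= ltr_pdivrMr// mul1r.
  - exact: dpow_ge0.
  - apply: psd_of_int_cnd => [s t||c]; first exact: dpow_sym.
      exact: dpow_diag.
    exact: roundness_int_cnd.
have De s t : D s t `^ (p / q) = dpow p (z s) (z t).
  by rewrite /D /dpow -powRrM mulrC divfK ?gt_eqF.
pose c (t : 'I_n.+1 + 'I_n.+1) : R := if t is inl _ then 1 else -1.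
have c0 : \sum_t c t = 0.
  by rewrite big_sumType /= -big_split /= big1// => i _; rewrite /c subrr.
have := cD c c0.
rewrite (eq_quad _ De) /quad !big_sumType /= => h; rewrite -subr_le0; move: h.
congr (is_true (_ <= 0)).
have C' : \sum_i \sum_j dpow p (y i) (x j) = \sum_i \sum_j dpow p (x i) (y j).
  by rewrite exchange_big; apply: eq_bigr => i _; apply: eq_bigr => j _;
    exact: dpow_sym.
rewrite mulr2n -[X in _ - (_ + X)]C' -!big_split -sumrB /=.
apply: eq_bigr => i _; rewrite !big_sumType /= -!big_split -sumrB /=.
by apply: eq_bigr => j _; ring.
Qed.

(** For fixed points both sides are continuous in the exponent at p > 0, also where a distance is
    0. *)
Lemma roundness_left_limit p : 0 < p ->
  (forall q, 0 < q < p -> roundness_ineq X q) -> roundness_ineq X p.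
Proof.
move=> p0 h; apply/(roundness_ineqP p0) => n x y.
(* The exponents stay at least p/2, hence positive, and increase to p. *)
pose q (k : nat) := p - p / 2 * k.+1%:R^-1.
have q0 k : 0 < q k < p.
  have k0 : (0 : R) < k.+1%:R^-1 by rewrite invr_gt0.
  have k1 : k.+1%:R^-1 <= (1 : R) by rewrite invf_le1// ler1n.
  have t0 : 0 < p / 2 * k.+1%:R^-1 by rewrite mulr_gt0// divr_gt0.
  have t1 : p / 2 * k.+1%:R^-1 <= p / 2 by rewrite ler_piMr// divr_ge0// ltW.
  by rewrite /q subr_gt0 gtrBl t0 andbT (le_lt_trans t1)// ltr_pdivrMr//
    ltr_pMr// ltr1n.
have qp : q k @[k --> \oo] --> p.
  rewrite -[X in _ --> X]subr0; apply: cvgB; first exact: cvg_cst.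
  rewrite -(mulr0 (p / 2)); apply: cvgMr; exact: cvg_harmonic.
have cd u v : dpow (q k) u v @[k --> \oo] --> dpow p u v.
  rewrite /dpow; have [->|d0] := eqVneq (mdist u v) 0.
    rewrite powR0 ?gt_eqF//; have -> : (fun k => 0 `^ q k) = fun=> 0 :> R.
      by apply/funext => k; rewrite powR0// gt_eqF//; case/andP: (q0 k).
    exact: cvg_cst.
  rewrite /powR (negbTE d0); apply: continuous_cvg;
    first exact: continuous_expR.
  exact: cvgMl.
apply: (@ler_cvg_to _ \oo _ _
  (fun k => \sum_i \sum_j (dpow (q k) (x i) (x j) + dpow (q k) (y i) (y j)))
  (fun k => (\sum_i \sum_j dpow (q k) (x i) (y j)) *+ 2)).
- apply: cvg_big => [|i _]; first exact: add_continuous.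
  apply: cvg_big => [|j _]; first exact: add_continuous.
  exact: cvgD.
- apply: cvgMn; apply: cvg_big => [|i _]; first exact: add_continuous.
  by apply: cvg_big => [|j _]; first exact: add_continuous.
- near=> k; have /andP[qk _] := q0 k.
  by apply: (proj1 (roundness_ineqP qk)); apply: h.
Unshelve. all: by end_near. Qed.

Lemma roundness_ineq0 : roundness_ineq X 0.
Proof.
move=> n x y _.
rewrite (eq_bigr (fun i : 'I_n => \sum_(j < n | (i < j)%N) (1 + 1))) =>
  [|i _]; last first.
  by apply: eq_bigr => j _; rewrite !powRr0.
rewrite [leRHS](eq_bigr (fun i : 'I_n => \sum_(j < n) 1)) => [|i _]; last first.
  by apply: eq_bigr => j _; rewrite !powRr0.
have := @sum_sym_diag0 R n (fun i j => (i != j)%:R).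
rewrite -(ler_pMn2r (n := 1))// !mulr1n => e.
have -> : \sum_(i < n) \sum_(j < n | (i < j)%N) (1 + 1 : R) =
    \sum_(i < n) \sum_(j < n) (i != j)%:R.
  rewrite e => [|i j|i]; rewrite ?eqxx// 1?eq_sym//.
  rewrite -sumrMnl; apply: eq_bigr => i _; rewrite -sumrMnl;
    apply: eq_bigr => j ij.
  by rewrite neq_ltn ij mulr2n.
by apply: ler_sum => i _; apply: ler_sum => j _; case: (_ != _).
Qed.

(** Each positive q < p lies below some exponent r satisfying the inequality, so q satisfies it too,
    and p follows as a limit. In particular a finite supremum is attained. *)
Lemma roundness_ineq_le p :
  0 <= p -> (p%:E <= generalized_roundness X)%E -> roundness_ineq X p.
Proof.
rewrite le_eqVlt => /predU1P[<- _|p0 hp]; first exact: roundness_ineq0.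
apply: roundness_left_limit => // q /andP[q0 qp].
have : (q%:E < generalized_roundness X)%E by rewrite (lt_le_trans _ hp)//
  lte_fin.
move=> /ereal_sup_gt[_ [r [_ rr] <-]]; rewrite lte_fin => qr.
exact: roundness_lt rr.
Qed.

End Roundness.

Local Close Scope classical_set_scope.

(** * Isometries of the lattice L_k *)

Section Cyclic.
Variables (p : nat) (p_gt1 : (1 < p)%N).

(** The distance from [v] to 0 around a cycle of length [p]. *)
Definition cyclic_norm (v : 'Z_p) : nat := minn v (p - v).

Lemma Zp_lt (v : 'Z_p) : (v < p)%N.
Proof. by have := ltn_ord v; rewrite [X in (_ < X)%N]Zp_cast. Qed.

Lemma val_ZpN (v : 'Z_p) : \val (- v) = ((p - v) %% p)%N.
Proof. rewrite /= [X in (X - v)%N]Zp_cast// [X in (_ %% X)%N]Zp_cast//. Qed.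

Lemma val_ZpD (v w : 'Z_p) : \val (v + w) = ((v + w) %% p)%N.
Proof. by rewrite /= [X in (_ %% X)%N]Zp_cast. Qed.

Lemma cyclic_normN v : cyclic_norm (- v) = cyclic_norm v.
Proof.
have := Zp_lt v; rewrite /cyclic_norm val_ZpN; have [->|v0] := posnP v.
  by rewrite subn0 modnn subn0.
by move=> vp; rewrite modn_small; lia.
Qed.

Lemma cyclic_norm_eq v w : cyclic_norm v = cyclic_norm w -> v = w \/ v = - w.
Proof.
move=> e; have vp := Zp_lt v; have wp := Zp_lt w.
have [vw|vw] := eqVneq (v : nat) w; first by left; exact: val_inj.
right; apply: val_inj; rewrite val_ZpN.
move: e vw; rewrite /cyclic_norm /= => e vw.
rewrite modn_small; lia.
Qed.

Lemma cyclic_norm_natr m : (2 * m <= p)%N -> cyclic_norm m%:R = m.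
Proof.
by move=> mp; rewrite /cyclic_norm val_Zp_nat// modn_small; lia.
Qed.

(* The subtractions on the right are truncated: their sum is |v - w|. *)
Lemma cyclic_normB v w :
  cyclic_norm (v - w) =
  minn ((v - w) + (w - v))%N (p - ((v - w) + (w - v)))%N.
Proof.
have vp := Zp_lt v; have wp := Zp_lt w.
have -> : cyclic_norm (v - w) = minn ((v + (p - w)) %% p)%N (p - (v +
  (p - w)) %% p)%N.
  by rewrite /cyclic_norm val_ZpD val_ZpN modnDmr.
have [vw|vw] := leqP w v.
  have -> : (v + (p - w) = (v - w) + p)%N by lia.
  by rewrite modnDr modn_small; lia.
by rewrite modn_small; lia.
Qed.

End Cyclic.

Section Lattice.
Variables (R : realType) (k : nat) (k_gt1 : (1 < k)%N).

Let K := (k ^ (2 * k))%N.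

Let K_gt1 : (1 < K)%N.
Proof. by rewrite -(exp1n (2 * k)) ltn_exp2r//; lia. Qed.

Let kk_gt0 : 0 < k%:R ^+ k :> R.
Proof. by rewrite exprn_gt0// ltr0n; lia. Qed.

Lemma L_seq_uniq : uniq (L_seq R k).
Proof.
rewrite map_inj_uniq ?iota_uniq// => i j /mulIf e.
by apply/eqP; rewrite -(eqr_nat R); apply/eqP/e; rewrite invr_neq0// gt_eqF.
Qed.

Lemma size_L_seq : size (L_seq R k) = K.
Proof. by rewrite size_map size_iota. Qed.

Lemma nth_L_seq i : (i < K)%N -> nth 0 (L_seq R k) i = i.+1%:R * k%:R ^- k.
Proof. by move=> iK; rewrite (nth_map 0%N) ?size_iota// nth_iota. Qed.

(** Listed in increasing order, the points have spacing k^(-k), and K = k^(2k) of them close up to a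
    circle of circumference k^k, the constant in [chi]. *)
Lemma chi_cyclic : exists (e : L R k -> 'Z_K) (e' : 'Z_K -> L R k),
  [/\ cancel e e', cancel e' e &
      forall x y, chi x y = (cyclic_norm (e x - e y))%:R / k%:R ^+ k].
Proof.
pose idx (x : L R k) := index (ssval x) (L_seq R k).
have idxK x : (idx x < K)%N by rewrite -size_L_seq index_mem; exact: ssvalP.
have nth_idx x : nth 0 (L_seq R k) (idx x) = ssval x by rewrite nth_index//;
  exact: ssvalP.
pose e x : 'Z_K := (idx x)%:R.
have eE x : e x = idx x :> nat by rewrite val_Zp_nat// modn_small.
have nthP (v : 'Z_K) : nth 0 (L_seq R k) v \in L_seq R k.
  by rewrite mem_nth// size_L_seq; exact: Zp_lt.
pose e' (v : 'Z_K) : L R k := SeqSub (nthP v).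
exists e, e'; split.
- move=> x; apply: val_inj; change (nth 0 (L_seq R k) (e x) = ssval x).
  by rewrite eE nth_idx.
- move=> v; apply: val_inj; change (nat_of_ord (e (e' v)) = v).
  rewrite eE /idx /= index_uniq ?L_seq_uniq//.
  by rewrite size_L_seq; exact: Zp_lt.
- move=> x y; rewrite cyclic_normB// !eE /chi -!nth_idx !nth_L_seq//.
  have -> : `|(idx x).+1%:R / k%:R ^+ k - (idx y).+1%:R / k%:R ^+ k| =
      ((idx x - idx y) + (idx y - idx x))%:R / k%:R ^+ k :> R.
    rewrite -mulrBl normrM [`|_^-1|]gtr0_norm ?invr_gt0//; congr (_ * _).
    have [h|/ltnW h] := leqP (idx y) (idx x).
      by rewrite -natrB ?ltnS// subSS normr_nat; congr _%:R; lia.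
    by rewrite distrC -natrB ?ltnS// subSS normr_nat; congr _%:R; lia.
  set d := (_ + _)%N; have dK : (d <= K)%N.
    by have := idxK x; have := idxK y; rewrite /d; lia.
  have -> : k%:R ^+ k - d%:R / k%:R ^+ k = (K - d)%:R / k%:R ^+ k :> R.
    rewrite natrB// mulrBl; congr (_ - _).
    by rewrite /K mulnC muln2 -addnn expnD natrM !natrX mulfK// gt_eqF.
  rewrite natr_min minr_pMl// invr_ge0; exact: ltW.
Qed.

Lemma chiC (x y : L R k) : chi x y = chi y x.
Proof. by rewrite /chi distrC. Qed.

Lemma chixx (x : L R k) : chi x x = 0.
Proof. by rewrite /chi subrr normr0 subr0 min_l// ltW. Qed.

Lemma chi_two_point (x y x' y' : L R k) : chi x y = chi x' y' ->
  exists h : {perm L R k},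
    [/\ forall a b, chi (h a) (h b) = chi a b, h x = x' & h y = y'].
Proof.
have [e [e' [eK e'K chiE]]] := chi_cyclic.
rewrite !chiE => /(mulIf (invr_neq0 (lt0r_neq0 kk_gt0)))/eqP.
rewrite eqr_nat => /eqP/(cyclic_norm_eq K_gt1) exy.
have [sg [sgK sgB sgE sgN]] : exists sg : 'Z_K -> 'Z_K, [/\ injective sg,
    forall a b, sg (a - b) = sg a - sg b,
    sg (e x - e y) = e x' - e y' &
    forall a, cyclic_norm (sg a) = cyclic_norm a].
  case: exy => exy; first by exists id; split.
  exists -%R; split; first exact: oppr_inj.
  - by move=> a b; rewrite opprB opprK addrC.
  - by rewrite exy opprK.
  - exact: cyclic_normN.
(* The isometry is a rotation or a reflection: [sg] is the identity or negation on the cycle, and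
   the translations move x to 0 and 0 to x'. *)
have h_inj : injective (fun a => e' (sg (e a - e x) + e x')).
  by move=> a b /(can_inj e'K)/addIr/sgK/addIr/(can_inj eK).
exists (perm h_inj); split => [a b||]; rewrite !permE.
- rewrite !chiE !e'K.
  have -> (u v w : 'Z_K) : u + w - (v + w) = u - v by ring.
  by rewrite -sgB sgN opprB addrA subrK.
- by rewrite subrr -(subrr (e x)) sgB subrr add0r eK.
- by rewrite -opprB -[X in sg X]sub0r -(subrr (e x - e y)) sgB sgE sgB sgE
    -[RHS]eK; congr e'; ring.
Qed.

(** The points d, -d and 0: the bound makes 2d at most half the circle, so the distances from 0 add
    up. *)
Lemma chi_three_points (d : nat) : (4 * d <= K)%N ->
  exists a b c : L R k,
    [/\ chi a c = d%:R / k%:R ^+ k, chi b c = d%:R / k%:R ^+ k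
      & chi a b = (2 * d)%:R / k%:R ^+ k].
Proof.
move=> dK; have [e [e' [eK e'K chiE]]] := chi_cyclic.
exists (e' d%:R), (e' (- d%:R)), (e' 0); rewrite !chiE !e'K !subr0.
rewrite opprK -natrD cyclic_normN//.
by rewrite !cyclic_norm_natr//; [split=> //; rewrite mul2n addnn|lia..].
Qed.

End Lattice.

(** * Averages over transitive group actions *)

(** By transitivity the left side does not depend on the base point in [S]; summing it over all base
    points and exchanging the sums gives the average. *)
Lemma sum_act_transitive (R : numFieldType) (aT : finGroupType) (rT : finType)
    (to : {action aT &-> rT}) (G : {group aT}) (S : {set rT}) (F : rT -> R)
    (x : rT) :
  [transitive G, on S | to]%g -> x \in S ->
  \sum_(g in G) F (to x g) = #|G|%:R * (#|S|%:R^-1 * \sum_(y in S) F y).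
Proof.
move=> trS Sx.
have const y : y \in S -> \sum_(g in G) F (to y g) = \sum_(g in G) F (to x g).
  move=> /(atransP2 trS Sx)[h Gh ->].
  rewrite [RHS](reindex_inj (mulgI h)) /=.
  by apply: eq_big => [g|g _]; rewrite ?groupMl// actM.
have S0 : #|S|%:R != 0 :> R by rewrite pnatr_eq0 -lt0n; apply/card_gt0P;
  exists x.
apply: (mulfI S0); rewrite !mulrA -(mulrC #|G|%:R) mulfK//.
transitivity (\sum_(y in S) \sum_(g in G) F (to y g)).
  by rewrite (eq_bigr _ const) sumr_const mulr_natl.
rewrite exchange_big /= mulr_natl -sumr_const; apply: eq_bigr => g Gg.
rewrite [RHS](reindex_inj (act_inj to g)) /=.
apply: eq_bigl => y; apply/esym; move: trS => /atrans_acts trS.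
exact: (acts_act trS).
Qed.

(** * Averages over (s, m)-pairs *)

(** Induction on the size of [A :\: B]: a transposition exchanges a point of [A :\: B] with one of
    [B :\: A]. *)
Lemma perm_of_eq_card (T : finType) (A B : {set T}) : #|A| = #|B| ->
  exists g : {perm T}, forall i, (g i \in B) = (i \in A).
Proof.
have [n] := ubnP #|A :\: B|; elim: n A => // n IH A; rewrite ltnS => An eAB.
case: (set_0Vmem (A :\: B)) => [/eqP|[a aAB]].
  rewrite finset.setD_eq0 => AB; have -> : A = B by apply/eqP;
    rewrite eqEcard AB eAB leqnn.
  by exists 1%g => i; rewrite perm1.
have [b bBA] : exists b, b \in B :\: A.
  apply/card_gt0P; move: eAB; rewrite -(cardsID B A) -(cardsID A B)
    finset.setIC => /addnI <-.
  by apply/card_gt0P; exists a.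
move: (aAB) (bBA); rewrite !inE => /andP[aB aA] /andP[bA bB].
have ab : a != b by apply: contraNneq aB => ->.
pose A' := b |: A :\ a.
have [|| g gP] := IH A'.
- apply: leq_trans An; apply: proper_card; apply/fintype.properP; split.
    apply/fintype.subsetP => x; rewrite !inE => /andP[xB]; rewrite xB /=.
    by case/predU1P => [xb|/andP[]//]; rewrite xb bB in xB.
  by exists a => //; rewrite !inE eqxx aB (negbTE ab).
- by rewrite cardsU1 !inE (negbTE bA) andbF add1n -eAB (cardsD1 a A) aA.
exists (tperm a b * g)%g => i; rewrite permM gP !inE.
case: tpermP => [->|->|/eqP/negbTE ia /eqP/negbTE ib].
- by rewrite eqxx aA.
- by rewrite eqxx (negbTE ab) (negbTE bA).
- by rewrite ia ib.
Qed.

Lemma card_ord_itv (N a c : nat) : (a <= c <= N)%N ->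
  #|[set i : 'I_N | (a <= i < c)%N]%SET| = (c - a)%N.
Proof.
case/andP => ac cN.
have f_lt (j : 'I_(c - a)) : (a + j < N)%N by have := ltn_ord j; lia.
have f_inj : injective (fun j => Ordinal (f_lt j)).
  by move=> i j [] /addnI/val_inj.
rewrite -[RHS]card_ord -(card_imset _ f_inj); apply: eq_card => i.
rewrite inE; apply/idP/imsetP => [/andP[ai ic]|[j _ ->] /=].
  have h : (i - a < c - a)%N by lia.
  by exists (Ordinal h) => //; apply: val_inj => /=; lia.
by have := ltn_ord j; lia.
Qed.

Section Pairs.
Variables (R : realType) (k : nat) (k_gt1 : (1 < k)%N).

(** A coordinate permutation matches the two sets of differing coordinates; then paired coordinates
    have equal distances, [2 ^ s] or 0, and [chi_two_point] moves each of them. The resulting map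
    preserves pairs of every type, so one group serves for two types at once. *)
Lemma sm_pair_transitive s m (x y x' y' : M R k) :
  is_sm_pair s m x y -> is_sm_pair s m x' y' ->
  exists g : {perm M R k}, [/\
    forall s' m' a b, is_sm_pair s' m' (g a) (g b) = is_sm_pair s' m' a b,
    g x = x' & g y = y'].
Proof.
move=> /andP[/forallP xy_chi /eqP xy_card] /andP[/forallP xy_chi' /eqP
  xy_card'].
have [pi piP] := perm_of_eq_card (etrans xy_card' (esym xy_card)).
have /choice[h hP] i : exists h : {perm L R k},
    [/\ forall a b, chi (h a) (h b) = chi a b, h (x (pi i)) =
      x' i & h (y (pi i)) = y' i].
  apply: chi_two_point => //.
  have := piP i; rewrite !inE; have := xy_chi (pi i); have := xy_chi' i.
  have [-> _|_ /eqP -> ] := eqVneq (x' i) (y' i).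
    by have [-> _ _|//] := eqVneq (x (pi i)) (y (pi i)); rewrite !chixx.
  by have [//|_ /eqP ->] := eqVneq (x (pi i)) (y (pi i)).
pose G (a : M R k) : M R k := [ffun i => h i (a (pi i))].
have G_inj : injective G.
  move=> a b /ffunP ab; apply/ffunP => i; have := ab ((pi^-1)%g i).
  by rewrite !ffunE permKV => /perm_inj.
exists (perm G_inj); split => [s' m' a b||]; rewrite !permE; last 2 first.
- by apply/ffunP => i; rewrite ffunE; case: (hP i).
- by apply/ffunP => i; rewrite ffunE; case: (hP i).
rewrite /is_sm_pair; congr (_ && _); last congr (_ == _).
  apply/forallP/forallP => H i.
    have := H ((pi^-1)%g i); rewrite !ffunE permKV (inj_eq perm_inj).
    by have [-> _ _] := hP ((pi^-1)%g i).
  rewrite !ffunE (inj_eq perm_inj); have [-> _ _] := hP i; exact: H.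
rewrite -(card_imset [set i | a i != b i]%SET (@perm_inj _ (pi^-1)%g)).
apply: eq_card => i; rewrite inE !ffunE (inj_eq perm_inj).
apply/idP/imsetP => [ab|[j + ->]]; last by rewrite inE permKV.
by exists (pi i); rewrite ?inE ?permK.
Qed.

Lemma ThetaP s m (P : {set M R k}) :
  reflect (exists x y, P = [set x;
    y]%SET /\ is_sm_pair s m x y) (P \in Theta R k s m).
Proof.
rewrite inE; apply: (iffP existsP) =>
  [[x /existsP[y /andP[/eqP -> xy]]]|[x [y [-> xy]]]].
  by exists x, y.
by exists x; apply/existsP; exists y; rewrite eqxx.
Qed.

Lemma setact_set2 (g : {perm M R k}) (x y : M R k) :
  ('P^*)%act [set x; y]%SET g = [set g x; g y]%SET.
Proof. by rewrite /= /setact imsetU1 imset_set1. Qed.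

Lemma sm_isometry_astabs (g : {perm M R k}) s m :
  (forall a b, is_sm_pair s m (g a) (g b) = is_sm_pair s m a b) ->
  (g \in 'N(Theta R k s m | 'P^*))%g.
Proof.
move=> gP; rewrite !inE /=; apply/fintype.subsetP => P /ThetaP[x [y [-> xy]]].
by rewrite inE setact_set2; apply/ThetaP; exists (g x), (g y); rewrite gP.
Qed.

Lemma sm_pair_atrans (G : {group {perm M R k}}) s m :
  (exists x y, is_sm_pair (R := R) (k := k) s m x y) ->
  (G \subset 'N(Theta R k s m | 'P^*))%g ->
  (forall g : {perm M R k}, (forall s' m' a b, is_sm_pair s' m' (g a) (g b) =
    is_sm_pair s' m' a b) ->
     g \in G) ->
  [transitive G, on Theta R k s m | 'P^*]%g.
Proof.
move=> [x [y xy]] GN GP; apply/imsetP; exists [set x; y]%SET.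
  by apply/ThetaP; exists x, y.
apply/setP => P; apply/ThetaP/orbitP => [[x' [y' [-> xy']]]|[g Gg <-]].
  have [g [gP <- <-]] := sm_pair_transitive xy xy'.
  by exists g; [exact: GP|rewrite setact_set2].
have := astabs_act [set x; y]%SET (fintype.subsetP GN _ Gg).
rewrite (_ : [set x; y]%SET \in Theta R k s m); last by apply/ThetaP;
  exists x, y.
by move=> /ThetaP.
Qed.

Lemma simplex_average (B : metricType R) (f : M R k -> B) (p : R)
    (s s' : int) (m m' : nat) (u v : 'I_k -> M R k) :
  roundness_ineq B p ->
  (forall i j, is_sm_pair s m (u i) (v j)) ->
  (forall i j, i != j -> is_sm_pair s' m' (u i) (u j)) ->
  (forall i j, i != j -> is_sm_pair s' m' (v i) (v j)) ->
  (1 - 1 / k%:R) * ((N R k s' m')^-1 *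
      \sum_(P in Theta R k s' m') on_pair (dist_pow f p) P) <=
  (N R k s m)^-1 * \sum_(P in Theta R k s m) on_pair (dist_pow f p) P.
Proof.
move=> rp uv uu vv; set F := on_pair _;
  set A' := _ * (\sum_(P in Theta _ _ s' _) _).
set A := _ * (\sum_(P in _) _).
(* The joint stabiliser of both sets of pairs is a group by construction and contains the maps of
   [sm_pair_transitive], hence is transitive on each set. *)
pose G := ('N(Theta R k s m | 'P^*) :&: 'N(Theta R k s' m' | 'P^*))%G.
have GP (g : {perm M R k}) : (forall s' m' a b, is_sm_pair s' m' (g a) (g b) =
  is_sm_pair s' m' a b) ->
    g \in G.
  by move=> gP; rewrite finset.in_setI !sm_isometry_astabs.
have i0 : 'I_k by exists 0%N; lia.
have i1 : {i1 : 'I_k | i0 != i1}.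
  case: (i0 =P Ordinal k_gt1) => [e|/eqP ?]; last by exists (Ordinal k_gt1).
  have h : (0 < k)%N by lia.
  by exists (Ordinal h); rewrite e.
have Favg t l (a b : M R k) : is_sm_pair t l a b -> (G \subset 'N(Theta R k t l
  | 'P^*))%g ->
    \sum_(g in G) dist_pow f p (g a) (g b) =
    #|G|%:R * ((N R k t l)^-1 * \sum_(P in Theta R k t l) F P).
  move=> ab GN; have trG : [transitive G, on Theta R k t l | 'P^*]%g.
    by apply: sm_pair_atrans => //; exists a, b.
  have abT : [set a; b]%SET \in Theta R k t l by apply/ThetaP; exists a, b.
  rewrite -(sum_act_transitive F trG abT); apply: eq_bigr => g _.
  by rewrite setact_set2 /F on_pairE//; exact: dist_powC.
have G1 : (G \subset 'N(Theta R k s m | 'P^*))%g by exact: finset.subsetIl.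
have G2 : (G \subset 'N(Theta R k s' m' | 'P^*))%g by exact: finset.subsetIr.
have : \sum_(g in G) \sum_(i < k) \sum_(j < k | (i < j)%N)
     (dist_pow f p (g (u i)) (g (u j)) + dist_pow f p (g (v i)) (g (v j))) <=
   \sum_(g in G) \sum_(i < k) \sum_(j < k) dist_pow f p (g (u i)) (g (v j)).
  apply: ler_sum => g _.
  exact: (rp k (fun i => f (g (u i))) (fun i => f (g (v i)))).
rewrite exchange_big [leRHS]exchange_big /=.
under [leRHS]eq_bigr => i _.
  rewrite exchange_big /=.
  under eq_bigr do rewrite (Favg s m _ _ _ G1)// -/A.
  rewrite sumr_const card_ord; over.
rewrite sumr_const card_ord.
have -> : \sum_(i < k) \sum_(g in G) \sum_(j < k | (i < j)%N)
     (dist_pow f p (g (u i)) (g (u j)) + dist_pow f p (g (v i)) (g (v j))) =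
   (\sum_(i < k) \sum_(j < k | (i < j)%N) (i != j)%:R * (#|G|%:R * A')) *+ 2.
  rewrite -sumrMnl; apply: eq_bigr => i _; rewrite exchange_big /= -sumrMnl.
  apply: eq_bigr => j ij; have ij' : i != j by rewrite neq_ltn ij.
  rewrite ij' mul1r big_split /= (Favg s' m' _ _ (uu _ _ ij') G2).
  by rewrite (Favg s' m' _ _ (vv _ _ ij') G2) mulr2n.
(* The inner pairs of the two simplices together amount to one term per ordered pair with i != j,
   that is k(k - 1) terms. *)
rewrite -(sum_sym_diag0 (F := fun i j : 'I_k =>
  (i != j)%:R * (#|G|%:R * A'))); last 2 first.
- by move=> i j; rewrite eq_sym.
- by move=> i; rewrite eqxx mul0r.
have row (i : 'I_k) : \sum_j (i != j)%:R = k%:R - 1 :> R.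
  have -> : k%:R = \sum_(j < k) 1 :> R by rewrite sumr_const card_ord.
  rewrite (bigD1 i)//= [in RHS](bigD1 i)//= eqxx add0r addrAC subrr add0r.
  by apply: eq_bigr => j; rewrite eq_sym => ->.
under eq_bigr do rewrite -mulr_suml row.
rewrite sumr_const card_ord -[leLHS]mulr_natl -[leRHS]mulr_natl -[X in _ <=
  _ * X]mulr_natl.
have g0 : 0 < #|G|%:R :> R by rewrite ltr0n cardG_gt0.
have k0 : 0 < k%:R :> R by rewrite ltr0n; lia.
rewrite ler_pM2l// [X in X <= _]mulrCA [X in _ <= X]mulrCA ler_pM2l// => h.
rewrite -(ler_pM2l k0); suff -> : k%:R * ((1 - 1 / k%:R) * A') =
  (k%:R - 1) * A' by exact: h.
by field; rewrite gt_eqF.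
Qed.

End Pairs.

(** * The double simplex *)

Lemma lattice_step (R : realType) (n k : nat) (s : int) :
  k = n.+2 -> ~~ odd n -> - n%:Z <= s -> s < n%:Z ->
  exists a b c : L R k,
    [/\ chi a c = 2 ^ s, chi b c = 2 ^ s & chi a b = 2 ^ (s + 1)].
Proof.
move=> kn n_even s_ge s_lt.
have [j sE] : exists j : nat, s = j%:Z - n%:Z by exists (absz (s + n%:Z)); lia.
have kE : k = (2 * k./2)%N.
  by rewrite mul2n -[LHS]odd_double_half kn /= negbK (negbTE n_even).
(* This is 2^s k^k, an integer because k is even and s >= -n; the bound s < n gives 4d <= k^(2k). *)
pose d := (2 ^ (j + 2) * k./2 ^ k)%N.
have k0 : k%:R ^+ k != 0 :> R by rewrite expf_neq0// pnatr_eq0 kn.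
have dE : d%:R / k%:R ^+ k = 2 ^ s :> R.
  apply: (mulIf k0); rewrite divfK// {1}kE /d !natrM !natrX exprMn mulrA.
  congr (_ * _); rewrite !exprnP -expfzDr//.
  by congr (_ ^ _); rewrite sE kn; lia.
have [||a [b [c [ac bc ab]]]] := @chi_three_points R k _ d.
  by rewrite kn.
  have jn : (j + 4 <= k + k)%N by rewrite kn; lia.
  have -> : (4 * d = 2 ^ (j + 4) * k./2 ^ k)%N by rewrite /d !expnD; lia.
  rewrite (_ : 2 * k = k + k)%N; last by lia.
  rewrite (expnD k) {3}kE expnMn mulnAC leq_mul2r; apply/orP; right.
  apply: (leq_trans (leq_pexp2l _ jn)) => //; rewrite expnD leq_mul2l.
  by apply/orP; right; rewrite leq_exp2r kn.
exists a, b, c; rewrite ac bc ab natrM -mulrA dE; split=> //.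
by rewrite addrC expfzDr.
Qed.

Section Simplex.
Variables (R : realType) (k b m : nat) (s : int) (x y z : L R k).
Hypotheses (k_gt1 : (1 < k)%N) (b_gt0 : (0 < b)%N).
Hypotheses (kmb : (k ^ m = 2 * b)%N) (m_lt : (m.+1 <= k)%N).
Hypotheses (xz : chi x z = 2 ^ s) (yz : chi y z = 2 ^ s)
  (xy : chi x y = 2 ^ (s + 1)).

(* The coordinates are cut into consecutive blocks of length b. *)
Definition vertex (q : nat) (j : 'I_k) : M R k :=
  [ffun i : 'I_(k ^ k) => if (i %/ b == q + j)%N then x
                else if (q <= i %/ b < q + k)%N then y else z].

Let neq (u v : L R k) r : chi u v = 2 ^ r -> (u == v) = false.
Proof.
move=> e; apply/negbTE/eqP => uv; move: e; rewrite uv chixx//.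
by move=> /esym/eqP; rewrite expfz_eq0 pnatr_eq0 andbF.
Qed.

Let blocks_fit : (2 * k * b <= k ^ k)%N.
Proof.
apply: (leq_trans (n := k ^ m.+1)); first by rewrite expnS kmb; lia.
by rewrite leq_exp2l.
Qed.

(** On the first k blocks the values x or y face z, on the next k blocks z faces x or y, and beyond
    them both are z: the vertices differ in 2kb = k^(m+1) coordinates. *)
Lemma vertex_cross_pair (j l : 'I_k) :
  is_sm_pair s m.+1 (vertex 0 j) (vertex k l).
Proof.
have xzn := neq xz; have yzn := neq yz.
have jk := ltn_ord j; have lk := ltn_ord l.
have val (i : 'I_(k ^ k)) : (vertex 0 j i != vertex k l i) =
  (i %/ b < 2 * k)%N /\
    ((i %/ b < 2 * k)%N -> chi (vertex 0 j i) (vertex k l i) = 2 ^ s).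
  rewrite !ffunE !add0n /=; move: (i %/ b)%N => c.
  have [ck|kc] := ltnP c k.
    rewrite (_ : (c == k + l)%N = false); last by lia.
    by case: (c == j); rewrite ?xzn ?yzn; split=> //; lia.
  rewrite (_ : (c == j) = false); last by lia.
  have [ckk|kkc] := ltnP c (k + k); last first.
    rewrite (_ : (c == k + l)%N = false); last by lia.
    by rewrite eqxx; split => [|]; lia.
  by case: (c == k + l)%N; rewrite eq_sym ?xzn ?yzn chiC; split=> //; lia.
apply/andP; split.
  by apply/forallP => i; have [-> h] := val i; apply/implyP => /h ->.
rewrite -[X in _ == X]subn0 expnS kmb (_ : k * (2 * b) = 2 * k * b)%N;
  last by lia.
rewrite -(@card_ord_itv (k ^ k)) ?blocks_fit//; apply/eqP/eq_card => i.
by rewrite !inE (proj1 (val i)) /= ltn_divLR.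
Qed.

(** The vertices differ exactly in the blocks q + j and q + l, where x faces y: 2b = k^m
    coordinates. *)
Lemma vertex_same_pair q (j l : 'I_k) : (q + k <= 2 * k)%N -> j != l ->
  is_sm_pair (s + 1) m (vertex q j) (vertex q l).
Proof.
move=> qk jl; have {}jl : (j : nat) <> l by move/val_inj => e;
  rewrite e eqxx in jl.
have xyn := neq xy.
have jk := ltn_ord j; have lk := ltn_ord l.
have val (i : 'I_(k ^ k)) : (vertex q j i != vertex q l i) =
      (i %/ b == q + j)%N || (i %/ b == q + l)%N /\
    (((i %/ b == q + j)%N || (i %/ b == q + l)%N) ->
       chi (vertex q j i) (vertex q l i) = 2 ^ (s + 1)).
  rewrite !ffunE /=; move: (i %/ b)%N => c.
  have [->|cj] := eqVneq c (q + j)%N.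
    rewrite (_ : (q + j == q + l)%N = false); last by lia.
    by rewrite leq_addr ltn_add2l jk xyn.
  have [->|cl] := eqVneq c (q + l)%N.
    by rewrite leq_addr ltn_add2l lk eq_sym xyn chiC.
  by rewrite eqxx.
apply/andP; split.
  by apply/forallP => i; have [-> h] := val i; apply/implyP => /h ->.
have block c : (c < 2 * k)%N -> #|[set i :
  'I_(k ^ k) | (i %/ b == c)%N]%SET| = b.
  move=> ck; have {2}-> : b = (c.+1 * b - c * b)%N by rewrite mulSn addnK.
  rewrite -(@card_ord_itv (k ^ k)).
    by apply: eq_card => i; rewrite !inE eqn_leq andbC leq_divRL// -[(i %/ b <=
      c)%N]ltnS ltn_divLR.
  by rewrite leq_pmul2r// leqnSn (leq_trans _ blocks_fit)// leq_pmul2r.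
have disj : [set i : 'I_(k ^ k) | (i %/ b == q + j)%N]%SET
    :&: [set i : 'I_(k ^ k) | (i %/ b == q + l)%N]%SET = finset.set0.
  by apply/setP => i; rewrite !inE; apply/negbTE; lia.
have := cardsU [set i : 'I_(k ^ k) | (i %/ b == q + j)%N]%SET
  [set i : 'I_(k ^ k) | (i %/ b == q + l)%N]%SET.
rewrite disj cards0 subn0 !block; [|lia..]; rewrite kmb mul2n -addnn => <-.
by apply/eqP/eq_card => i; rewrite !inE (proj1 (val i)).
Qed.

End Simplex.

(** * Iteration of the averaged inequality *)

Lemma average_step (R : realType) (n : nat) (B : metricType R)
    (f : M R n.+2 -> B) (p : R) (s : int) (m : nat) :
  ~~ odd n -> - n%:Z <= s -> s < n%:Z -> (0 < m <= n)%N -> roundness_ineq B p ->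
  (1 - 1 / n.+2%:R) * ((N R n.+2 (s + 1) m)^-1 *
      \sum_(P in Theta R n.+2 (s + 1) m) on_pair (dist_pow f p) P) <=
  (N R n.+2 s m.+1)^-1 *
      \sum_(P in Theta R n.+2 s m.+1) on_pair (dist_pow f p) P.
Proof.
move=> n_even s_ge s_lt /andP[m_gt0 m_le] rp.
have [x [y [z [xz yz xy]]]] := lattice_step R erefl n_even s_ge s_lt.
(* Half of k^m, exact because k is even and m is positive. *)
pose b := (n.+2 ^ m)./2.
have kmb : (n.+2 ^ m = 2 * b)%N.
  rewrite mul2n -[LHS]odd_double_half oddX /= negbK (negbTE n_even).
  by rewrite eqn0Ngt m_gt0.
have b_gt0 : (0 < b)%N by have : (0 < n.+2 ^ m)%N; [rewrite expn_gt0|lia].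
apply: (@simplex_average _ _ _ _ _ _ _ _ _ _ (vertex b x y z 0) (vertex b x y z
  n.+2)) => //.
- by move=> i j; apply: vertex_cross_pair => //; lia.
- by move=> i j; apply: vertex_same_pair => //; lia.
- by move=> i j; apply: vertex_same_pair => //; lia.
Qed.

(** Each step raises the scale exponent by one and lowers the other by one. As t <= 0, the exponent
    t + j stays below n for j < n, as [average_step] demands. *)
Lemma average_iter (R : realType) (n : nat) (B : metricType R)
    (f : M R n.+2 -> B) (p : R) (t : int) (j : nat) :
  ~~ odd n -> - n%:Z <= t -> t <= 0 -> (j <= n)%N -> roundness_ineq B p ->
  (1 - 1 / n.+2%:R) ^+ j * ((N R n.+2 (t + j%:Z) (n.+1 - j))^-1 *
      \sum_(P in Theta R n.+2 (t + j%:Z) (n.+1 - j)) on_pair (dist_pow f p) P)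
        <=
  (N R n.+2 t n.+1)^-1 *
      \sum_(P in Theta R n.+2 t n.+1) on_pair (dist_pow f p) P.
Proof.
move=> n_even t_ge t_le jn rp; elim: j jn => [|j IH] jn.
  by rewrite expr0 mul1r addr0 subn0.
apply: le_trans (IH (ltnW jn)); rewrite exprSr -mulrA ler_wpM2l//.
  by rewrite exprn_ge0// subr_ge0 ler_pdivrMr// mul1r ler1n.
have -> : t + j.+1%:Z = (t + j%:Z) + 1 by lia.
have -> : (n.+1 - j = (n.+1 - j.+1).+1)%N by lia.
by apply: average_step => //; lia.
Qed.

Theorem theorem2p5 (R : realType) (n : nat) (n_gt0 : (0 < n)%N)
    (n_even : ~~ odd n) (B : metricType R) (f : M R n.+2 -> B) :
  (generalized_roundness B \is a fin_num ->
   forall (p : R) (t : int),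
     0 <= p -> (p%:E <= generalized_roundness B)%E ->
     - n%:Z <= t -> t <= 0 ->
     (N R n.+2 t n.+1)^-1 *
       (\sum_(P in Theta R n.+2 t n.+1) on_pair (dist_pow f p) P) >=
     (1 - 1 / n.+2%:R) ^+ n *
       ((N R n.+2 (t + n%:Z) 1)^-1 *
         (\sum_(P in Theta R n.+2 (t + n%:Z) 1) on_pair (dist_pow f p) P)))
  /\
  (generalized_roundness B = +oo%E ->
   forall (p : R) (t : int),
     0 <= p ->
     - n%:Z <= t -> t <= 0 ->
     (N R n.+2 t n.+1)^-1 *
       (\sum_(P in Theta R n.+2 t n.+1) on_pair (dist_pow f p) P) >=
     (1 - 1 / n.+2%:R) ^+ n *
       ((N R n.+2 (t + n%:Z) 1)^-1 *
         (\sum_(P in Theta R n.+2 (t + n%:Z) 1) on_pair (dist_pow f p) P))).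
Proof.
(* Comparing p with the roundness in the extended reals treats the finite and the infinite case
   together. *)
have main (p : R) (t : int) : 0 <= p -> (p%:E <= generalized_roundness B)%E ->
     - n%:Z <= t -> t <= 0 ->
     (1 - 1 / n.+2%:R) ^+ n *
       ((N R n.+2 (t + n%:Z) 1)^-1 *
         (\sum_(P in Theta R n.+2 (t + n%:Z) 1) on_pair (dist_pow f p) P)) <=
     (N R n.+2 t n.+1)^-1 *
       (\sum_(P in Theta R n.+2 t n.+1) on_pair (dist_pow f p) P).
  move=> p0 hp t_ge t_le.
  have := average_iter f n_even t_ge t_le (leqnn n) (roundness_ineq_le p0 hp).
  by rewrite subSnn.
split=> [_|ry] p t p0; first exact: main.
by apply: main => //; rewrite ry leey.
Qed.
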